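(* Let $r\ge1$ be an integer, let $\mathcal{W}^i\subset\Delta(\mathcal{S})$, $i\in[r]$, and $\mathcal{U}^s\subset\Delta([r])^{\mathcal{A}}$, $s\in\mathcal{S}$, be nonempty compact sets, and let $$\mathcal{P}=\Big\{\Big(\sum_{i=1}^ru^i_{sa}w^i\Big)_{(s,a)\in\mathcal{S}\times\mathcal{A}} : (w^1,\dots,w^r)\in\prod_{i\in[r]}\mathcal{W}^i,\ (u_s)_{s\in\mathcal{S}}\in\prod_{s\in\mathcal{S}}\mathcal{U}^s\Big\}.$$ Then for all $\pi\in\Pi_{\mathsf S}$ and $V\in\mathbb{R}^{\mathcal{S}}$, $$\bigcap_{s\in\mathcal{S}}\arg\min_{P\in\mathcal{P}}\langle P_s,\pi_sV^\top\rangle\neq\emptyset .$$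
   Context: $\mathcal{S}$ (states) and $\mathcal{A}$ (actions) are finite nonempty sets; $\Delta(E)$ denotes the set of probability distributions on a finite set $E$; $[r]=\{1,\dots,r\}$. For $u_s\in\Delta([r])^{\mathcal{A}}$, write $u_s=(u_{sa})_{a\in\mathcal{A}}$ with $u_{sa}=(u^i_{sa})_{i\in[r]}\in\Delta([r])$. Elements of $\mathcal{P}$ are written $P=(P_{sa})_{(s,a)}$ with $P_{sa}\in\Delta(\mathcal{S})\subset\mathbb{R}^{\mathcal{S}}$, and $P_s=(P_{sa})_{a\in\mathcal{A}}\in\mathbb{R}^{\mathcal{A}\times\mathcal{S}}$. $\Pi_{\mathsf S}=\Delta(\mathcal{A})^{\mathcal{S}}$, $\pi_s=(\pi_{sa})_a$. $\pi_sV^\top$ is the matrix with entries $\pi_{sa}V_{s'}$ and $\langle A,B\rangle=\sum_{i,j}A_{ij}B_{ij}$, so $\langle P_s,\pi_sV^\top\rangle=\sum_a\pi_{sa}P_{sa}^\top V$. *)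

(* Defs.v *)
From HB Require Import structures.
From mathcomp Require Export all_boot all_order all_algebra.
From mathcomp Require Export all_classical all_reals all_analysis.

Set Implicit Arguments.
Unset Strict Implicit.
Unset Printing Implicit Defensive.

Import Order.TTheory GRing.Theory Num.Theory.
Import numFieldNormedType.Exports.

Local Open Scope classical_set_scope.
Local Open Scope ring_scope.

(* The space R^E carries the topology of pointwise convergence; as E is
   finite, this is the usual Euclidean topology. *)
Notation vec R E := {ptws E -> (R : Type)}.

Section Defs.
Context {R : realType}.

Definition simplex (E : finType) : set (vec R E) :=
  [set p | (forall e, 0 <= p e) /\ \sum_(e : E) p e = 1].

(* Delta(E)^I, inside (R^E)^I with the product topology. *)
Definition simplex_fam (I : Type) (E : finType) :
    set {ptws I -> vec R E} :=
  [set p | forall i, simplex (p i)].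

Definition frob (I J : finType) (X Y : I -> J -> R) : R :=
  \sum_(i : I) \sum_(j : J) X i j * Y i j.

Definition outer (I J : Type) (x : I -> R) (y : J -> R) : I -> J -> R :=
  fun i j => x i * y j.

Definition argmin (T : Type) (D : set T) (f : T -> R) : set T :=
  [set x | D x /\ forall y, D y -> f x <= f y].

(* [P s a s'] is the s'-coordinate of P_{sa}. *)
Definition factor_set (S A : finType) (r : nat)
    (W : 'I_r -> set (vec R S))
    (U : S -> set {ptws A -> vec R 'I_r}) : set (S -> A -> S -> R) :=
  [set P | exists (w : 'I_r -> vec R S) (u : S -> {ptws A -> vec R 'I_r}),
     [/\ forall i, W i (w i), forall s, U s (u s) &
         P = (fun s a s' => \sum_(i < r) u s a i * w i s')]].

End Defs.

(* Main.v *)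
Require Import Defs.
From mathcomp Require Import ring.
Set Implicit Arguments.
Unset Strict Implicit.
Unset Printing Implicit Defensive.
Import Order.TTheory GRing.Theory Num.Theory.
Import numFieldNormedType.Exports.
Local Open Scope classical_set_scope.
Local Open Scope ring_scope.

(** Once the weights [u_s] are fixed, the objective at state [s] is an average of
the numbers [<w^i, V>] with nonnegative coefficients [pi_sa u^i_sa]
([frob_mixture]).  Hence lowering every [<w^i, V>] lowers the objective of every
state at once, whatever the weights are: the best factors [w^i] depend neither
on [s] nor on [u].  So pick for each [i] a point of [W^i] that minimizes
[<., V>]; with these factors fixed, the objective at [s] depends on [u_s] alone,
and the sets [U^s] can be minimized over separately.  Both minima exist because
a linear functional on a compact set attains its infimum.  The element of the
factor set built from these choices is optimal at every state. *)

Section LinearMinimization.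
Context {R : realType}.

Lemma compact_argmin_neq0 (T : topologicalType) (K : set T) (f : T -> R) :
  K !=set0 -> compact K -> continuous f -> argmin K f !=set0.
Proof.
move=> K0 cK cf.
have [x /set_mem Kx xmin] :=
  compact_EVT_min K0 cK (continuous_subspaceT cf).
by exists x; split=> // y /mem_set; exact: xmin.
Qed.

Lemma linear_form_continuous (E : finType) (c : E -> R) :
  continuous (fun p : vec R E => \sum_(e : E) p e * c e).
Proof.
apply: continuous_big => [|e _ p]; first exact: add_continuous.
have ce := @proj_continuous E (fun=> R : topologicalType) e p.
exact: (continuous_comp ce (@mulrr_continuous R (c e) (p e))).
Qed.

Lemma frob_continuous (I J : finType) (Y : I -> J -> R) :
  continuous (fun X : {ptws I -> vec R J} => frob X Y).
Proof.
apply: continuous_big => [|i _ X]; first exact: add_continuous.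
have ci := @proj_continuous I (fun=> vec R J : topologicalType) i X.
exact: (continuous_comp ci (@linear_form_continuous J (Y i) (X i))).
Qed.

(** Mixing is linear in the factors, so the objective depends on the factor [w j]
only through the single number [\sum_k w j k * V k].  The right-hand side has
again the form [frob u _], which makes it the function of the weights to be
minimized. *)
Lemma frob_mixture (I J K : finType) (u : I -> J -> R) (w : J -> K -> R)
    (x : I -> R) (V : K -> R) :
  frob (fun i k => \sum_j u i j * w j k) (outer x V) =
  frob u (outer x (fun j => \sum_k w j k * V k)).
Proof.
apply: eq_bigr => i _; under eq_bigr do rewrite mulr_suml.
rewrite exchange_big; apply: eq_bigr => j _ /=.
by rewrite /outer !mulr_sumr; apply: eq_bigr => k _; ring.
Qed.

(** Nonnegativity of [u] and [x] is what makes smaller factor values better for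
every choice of weights, hence simultaneously for all states. *)
Lemma frob_outer_le (I J : finType) (u : I -> J -> R) (x : I -> R)
    (v v' : J -> R) :
  (forall i j, 0 <= u i j) -> (forall i, 0 <= x i) ->
  (forall j, v j <= v' j) -> frob u (outer x v) <= frob u (outer x v').
Proof.
move=> u0 x0 vv'; apply: ler_sum => i _; apply: ler_sum => j _.
by apply: ler_wpM2l => //; exact: ler_wpM2l.
Qed.

End LinearMinimization.

Theorem proposition7 (R : realType) (S A : finType)
    (hS : (0 < #|S|)%N) (hA : (0 < #|A|)%N)
    (r : nat) (hr : (1 <= r)%N)
    (W : 'I_r -> set (vec R S))
    (U : S -> set {ptws A -> vec R 'I_r})
    (W_sub : forall i, W i `<=` simplex (E := S))
    (W_neq0 : forall i, W i !=set0)
    (W_compact : forall i, compact (W i))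
    (U_sub : forall s, U s `<=` simplex_fam (I := A) (E := 'I_r))
    (U_neq0 : forall s, U s !=set0)
    (U_compact : forall s, compact (U s))
    (pi : S -> A -> R) (hpi : simplex_fam (pi : {ptws S -> vec R A}))
    (V : S -> R) :
  \bigcap_(s in [set: S])
    argmin (factor_set W U) (fun P => frob (P s) (outer (pi s) V)) !=set0.
Proof.
have /choice[w wmin] i :
    argmin (W i) (fun p => \sum_s p s * V s) !=set0.
  by apply: compact_argmin_neq0 => //; exact: linear_form_continuous.
pose v i := \sum_s w i s * V s.
have /choice[u umin] s : argmin (U s) (fun x => frob x (outer (pi s) v)) !=set0.
  by apply: compact_argmin_neq0 => //; exact: frob_continuous.
exists (fun s a s' => \sum_(i < r) u s a i * w i s') => s _; split.
  by exists w, u; split=> // [i|s']; [case: (wmin i)|case: (umin s')].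
move=> _ [w' [u' [Ww' Uu' ->]]]; rewrite !frob_mixture.
(* Improve the weights at the optimal factors, then the factors. *)
apply: (le_trans ((umin s).2 _ (Uu' s))).
apply: frob_outer_le => [a i|a|i].
- by have [+ _] := U_sub _ _ (Uu' s) a; apply.
- by have [+ _] := hpi s; apply.
- exact: (wmin i).2.
Qed.
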